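(* Every multilagrangian vector space admits a canonical basis. That is, let $W$, $V$ and $T$ be finite-dimensional real vector spaces related by a short exact sequence $0\to V\to W\xrightarrow{\pi}T\to0$, with $n=\dim T$, and let $\omega$ be a multilagrangian $(k+1)$-form on $W$ of rank $N$ and horizontality degree $k+1-r$, where $1\le r\le k+1$ and $k+1-r\le n$. Then there exists a basis $$\{\,e_i,\;e_\mu,\;e^{i_1\ldots i_s;\mu_1\ldots\mu_{k-s}}\mid 1\le i\le N,\;1\le\mu\le n,\;0\le s\le r-1,\;1\le i_1<\ldots<i_s\le N,\;1\le\mu_1<\ldots<\mu_{k-s}\le n\,\}$$ of a subspace of $W$ complementary to $\ker\omega$, with all $e_i$ and all $e^{i_1\ldots i_s;\mu_1\ldots\mu_{k-s}}$ in $V$ and with $\{\pi(e_\mu)\}$ a basis of $T$, such that, denoting by $\{e^i,e^\mu,e_{i_1\ldots i_s;\mu_1\ldots\mu_{k-s}}\}$ the corresponding dual basis (extended by zero on $\ker\omega$ to linear forms on $W$), $$\omega=\sum_{s=0}^{r-1}\frac1{s!}\frac1{(k-s)!}\;e_{i_1\ldots i_s;\mu_1\ldots\mu_{k-s}}\wedge e^{i_1}\wedge\ldots\wedge e^{i_s}\wedge e^{\mu_1}\wedge\ldots\wedge e^{\mu_{k-s}} .$$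
   Context: Here $k\ge1$ and $V$ is regarded as a subspace of $W$. Summation over repeated indices is understood, with $e_{i_1\ldots i_s;\mu_1\ldots\mu_{k-s}}$ extended antisymmetrically in the $i$'s and in the $\mu$'s separately; values of $s$ with $s>N$ or $k-s>n$ contribute nothing. A form $\alpha\in\bigwedge^mW^*$ is $(m-s)$-horizontal if $\mathrm i_{v_1}\cdots\mathrm i_{v_{s+1}}\alpha=0$ for all $v_1,\dots,v_{s+1}\in V$; the space of these is $\bigwedge^m_sW^*$. For $\omega\in\bigwedge^{k+1}_rW^*$ let $\omega^\flat(w)=\mathrm i_w\omega$ and $\ker\omega=\ker\omega^\flat\subset W$. For a subspace $L\subset V$ let $L^\perp\subset W^*$ be its annihilator in $W^*$ and $\bigwedge^k_{r-1}L^\perp=\bigwedge^kL^\perp\cap\bigwedge^k_{r-1}W^*$. A non-vanishing $\omega\in\bigwedge^{k+1}_rW^*$ is multilagrangian of rank $N$ and horizontality degree $k+1-r$ if $V$ has a subspace $L$ of codimension $N$ in $V$ with $\omega^\flat(L)=\bigwedge^k_{r-1}L^\perp$ (a multilagrangian subspace); for $r=1$ it is understood that $L=V$, $N=0$. A multilagrangian vector space is a quadruple $(W,V,T,\omega)$ consisting of finite-dimensional real vector spaces $W$, $V$, $T$ related by a short exact sequence $0\to V\to W\xrightarrow{\pi}T\to0$ and a multilagrangian $(k+1)$-form $\omega$ on $W$ of some rank $N$ and horizontality degree $k+1-r$, where $1\le r\le k+1$ and $k+1-r\le n=\dim T$. When $\omega$ is degenerate, a canonical basis of $W$ means a basis $\{e_i,e_\mu,e^{i_1\ldots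 i_s;\mu_1\ldots\mu_{k-s}}\mid1\le i\le N,\;1\le\mu\le n,\;0\le s\le r-1,\;1\le i_1<\ldots<i_s\le N,\;1\le\mu_1<\ldots<\mu_{k-s}\le n\}$ of a subspace of $W$ complementary to $\ker\omega$, with all $e_i$ and all $e^{i_1\ldots i_s;\mu_1\ldots\mu_{k-s}}$ in $V$ and with $\{\pi(e_\mu)\}$ a basis of $T$, such that, in terms of the corresponding dual basis $\{e^i,e^\mu,e_{i_1\ldots i_s;\mu_1\ldots\mu_{k-s}}\}$ (extended by zero on $\ker\omega$), $\omega=\sum_{s=0}^{r-1}\frac1{s!}\frac1{(k-s)!}\,e_{i_1\ldots i_s;\mu_1\ldots\mu_{k-s}}\wedge e^{i_1}\wedge\ldots\wedge e^{i_s}\wedge e^{\mu_1}\wedge\ldots\wedge e^{\mu_{k-s}}$. *)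

(* Defs.v *)
From mathcomp Require Import all_boot all_order all_algebra all_fingroup.
From mathcomp Require Import boolp classical_sets reals.

Set Implicit Arguments.
Unset Strict Implicit.
Unset Printing Implicit Defensive.

Import Order.TTheory GRing.Theory Num.Theory.
Local Open Scope ring_scope.
Local Open Scope classical_set_scope.

Definition short_exact (R : realType) (V W T : vectType R)
    (iota : 'Hom(V, W)) (pi : 'Hom(W, T)) : Prop :=
  [/\ lker iota = 0%VS, limg iota = lker pi & limg pi = fullv].

Section Forms.

Context {R : realType} {W : vectType R}.

Definition covector : Type := 'Hom(W, R^o).

(* Scalar functions of m vectors; the elements of the exterior power of the
   dual space are those in [ext_dual m] below. *)
Definition cochain (m : nat) : Type := m.-tuple W -> R.

Definition subst_at m (t : m.-tuple W) (i : 'I_m) (w : W) : m.-tuple W :=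
  [tuple if j == i then w else tnth t j | j < m].

Definition multilinear m (a : cochain m) : Prop :=
  forall (t : m.-tuple W) (i : 'I_m) (c : R) (u v : W),
    a (subst_at t i (c *: u + v)) =
    c * a (subst_at t i u) + a (subst_at t i v).

Definition alternating m (a : cochain m) : Prop :=
  forall (t : m.-tuple W) (i j : 'I_m),
    i != j -> tnth t i = tnth t j -> a t = 0.

Definition ext_dual m : set (cochain m) :=
  [set a | multilinear a /\ alternating a].
Arguments ext_dual : clear implicits.

Definition interior m (w : W) : cochain m -> cochain m.-1 :=
  match m with
  | 0 => fun _ _ => 0
  | m'.+1 => fun a t => a [tuple of w :: t]
  end.

(* Contracting a 0-form gives 0, so the condition is void when m < j. *)
Fixpoint killed_by (V : {vspace W}) (j m : nat) (a : cochain m) : Prop :=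
  match j with
  | 0 => a = (fun=> 0)
  | j'.+1 => forall v, v \in V -> killed_by V j' (interior v a)
  end.

(* These are the (m - s)-horizontal forms: [s] bounds the vertical degree. *)
Definition ext_dual_hor (V : {vspace W}) (m s : nat) : set (cochain m) :=
  ext_dual m `&` [set a | killed_by V s.+1 a].
Arguments ext_dual_hor : clear implicits.

(* The normalisation of the wedge product of m covectors is the one for which
   [interior w] is an antiderivation, without a factor 1/m!.  The list [f] is
   meant to have length m: this type avoids casts between equal lengths. *)
Definition wedge (m : nat) (f : seq covector) : cochain m :=
  fun t => \det (\matrix_(i < m, j < m) (f`_i (tnth t j) : R)).

Definition annihilator (L : {vspace W}) : set covector :=
  [set f | forall l, l \in L -> f l = 0].

(* The m-th exterior power of a subspace A of the dual space, as the span of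
   the wedge products of m elements of A. *)
Definition ext_power (A : set covector) (m : nat) : set (cochain m) :=
  [set a | exists (p : nat) (c : 'I_p -> R) (f : 'I_p -> m.-tuple covector),
     (forall j i, A (tnth (f j) i)) /\
     a = (fun t => \sum_(j < p) c j * wedge (f j) t)].
Arguments ext_power : clear implicits.

Definition flat k (omega : cochain k.+1) : W -> cochain k :=
  fun w => interior w omega.

Definition form_ker k (omega : cochain k.+1) : set W :=
  [set w | flat omega w = (fun=> 0)].

Definition multilagrangian_subspace (V : {vspace W}) (N r k : nat)
    (omega : cochain k.+1) (L : {vspace W}) : Prop :=
  [/\ (L <= V)%VS,
      \dim V = (\dim L + N)%N,
      (r = 1 -> L = V /\ N = 0)%N &
      flat omega @` [set l | l \in L] =
        ext_power (annihilator L) k `&` ext_dual_hor V k r.-1].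

(* The horizontality degree is k + 1 - r. *)
Definition multilagrangian (V : {vspace W}) (N r k : nat)
    (omega : cochain k.+1) : Prop :=
  [/\ ext_dual_hor V k.+1 r omega,
      omega <> (fun=> 0) &
      exists L : {vspace W}, multilagrangian_subspace V N r omega L].

End Forms.

Arguments covector {R} W.
Arguments cochain {R} W m.

Definition increasing (p s : nat) : seq (seq 'I_p) :=
  [seq J : seq 'I_p <- [seq tval t | t <- enum {: s.-tuple 'I_p}] |
    sorted ltn [seq val i | i <- J]].

(* The same list is used for a basis and for its dual basis.  Only the values
   of [E] at pairs of strictly increasing multi-indices of lengths s and k - s,
   with s < r, occur in it. *)
Definition frame (A : Type) (N n r k : nat)
    (e : 'I_N -> A) (f : 'I_n -> A) (E : seq 'I_N -> seq 'I_n -> A) : seq A :=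
  [seq e i | i <- enum 'I_N] ++
  [seq f mu | mu <- enum 'I_n] ++
  flatten [seq [seq E J M | J <- increasing N s,
                            M <- increasing n (k - s)%N]
          | s : nat <- iota 0 r].

Definition permute (A : Type) (s : nat) (sigma : 'S_s) (J : s.-tuple A) :
    s.-tuple A :=
  [tuple tnth J (sigma j) | j < s].

Definition biantisymmetric (R : realType) (W : vectType R) (N n : nat)
    (E : seq 'I_N -> seq 'I_n -> covector W) : Prop :=
  forall (s q : nat) (J : s.-tuple 'I_N) (M : q.-tuple 'I_n)
         (sigma : 'S_s) (tau : 'S_q),
    E (permute sigma J) (permute tau M) =
    ((-1) ^+ sigma * (-1) ^+ tau : R) *: E J M.

Definition dual_basis (R : realType) (W : vectType R)
    (X : seq W) (Y : seq (covector W)) (K : set W) : Prop :=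
  [/\ size Y = size X,
      (forall a b, (a < size X)%N -> (b < size X)%N ->
         Y`_a X`_b = (a == b)%:R) &
      (forall a w, (a < size X)%N -> K w -> Y`_a w = 0)].

(* The multi-indices in the sum are arbitrary, not only increasing. *)
Definition canonical_form (R : realType) (W : vectType R) (N n r k : nat)
    (e' : 'I_N -> covector W) (f' : 'I_n -> covector W)
    (E' : seq 'I_N -> seq 'I_n -> covector W) : cochain W k.+1 :=
  fun t => \sum_(s < r) (s`!)%:R^-1 * ((k - s)%N`!)%:R^-1 *
    \sum_(J : s.-tuple 'I_N) \sum_(M : (k - s)%N.-tuple 'I_n)
      wedge (E' J M :: [seq e' i | i <- J] ++ [seq f' mu | mu <- M]) t.

(* [e], [f] and [E] are the basis vectors e_i, e_mu and e^{J;M}.  The dual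
   family is determined by the basis: [dual_basis] fixes e', f' and the values
   of E' at increasing multi-indices, and [biantisymmetric] extends the latter
   to all multi-indices. *)
Definition canonical_basis (R : realType) (W T : vectType R) (V : {vspace W})
    (pi : 'Hom(W, T)) (N n r k : nat) (omega : cochain W k.+1)
    (e : 'I_N -> W) (f : 'I_n -> W) (E : seq 'I_N -> seq 'I_n -> W) : Prop :=
  let X := frame r k e f E in
  [/\ free X /\
      (exists K : {vspace W},
         [/\ [set w | w \in K] = form_ker omega,
             (<<X>> + K)%VS = fullv &
             (<<X>> :&: K)%VS = 0%VS]),
      (forall i, e i \in V),
      (forall s, (s < r)%N -> forall J M, J \in increasing N s ->
         M \in increasing n (k - s)%N -> E J M \in V),
      basis_of fullv [seq pi (f mu) | mu <- enum 'I_n] &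
      exists (e' : 'I_N -> covector W) (f' : 'I_n -> covector W)
             (E' : seq 'I_N -> seq 'I_n -> covector W),
        [/\ dual_basis X (frame r k e' f' E') (form_ker omega),
            biantisymmetric E' &
            omega = canonical_form r e' f' E']].

(* Main.v *)
(* Choose vectors c_a, indexed by the vertical indices i and the horizontal
   indices mu, that span a complement C of L in W adapted to V.  The contractions
   of omega with the vectors of L are exactly the k-forms that vanish on L and
   have vertical degree less than r, so they can be prescribed freely; moreover
   L is isotropic.  Hence adding suitable vectors of L to the c_a makes omega
   vanish on C, and then omega is determined by its contractions with L.  Take
   for e^{J;M} a vector of L whose contraction is e^J /\ e^M, and for e_{J;M}
   the covector w |-> omega (w, c_J, c_M), which is antisymmetric in J and in M
   and kills both C and ker omega. *)

Require Import Defs.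
From HB Require Import structures.
From mathcomp Require Import all_boot all_order all_algebra all_fingroup.
From mathcomp Require Import boolp classical_sets reals.
From mathcomp Require Import zify.

Set Implicit Arguments.
Unset Strict Implicit.
Unset Printing Implicit Defensive.

Import Order.TTheory GRing.Theory Num.Theory.
Local Open Scope ring_scope.


(** * Multilinear and alternating forms *)

Definition sign_symmetric (R : pzRingType) (A : Type) m (g : m.-tuple A -> R) :=
  forall (s : 'S_m) B, g (permute s B) = (-1) ^+ s * g B.

Section MultilinearForms.
Context {R : realType} {W : vectType R}.

Lemma subst_at_id m (t : m.-tuple W) i : subst_at t i (tnth t i) = t.
Proof. by apply: eq_from_tnth => j; rewrite tnth_mktuple; case: eqP => [->|]. Qed.

Lemma multilinear_covector m (a : cochain W m) t i : multilinear a ->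
  exists g : covector W, forall w, g w = a (subst_at t i w).
Proof.
move=> ml; pose f w : R^o := a (subst_at t i w).
have lf : linear f by move=> c u v; exact: ml.
pose F : {linear W -> R^o} := HB.pack f (GRing.isLinear.Build R W R^o _ f lf).
by exists (linfun F) => w; rewrite lfunE.
Qed.

Lemma multilinear_eq0 m (a : cochain W m) (X : 'I_m -> seq W) : multilinear a ->
  (forall t, (forall i, tnth t i \in X i) -> a t = 0) ->
  forall t, (forall i, tnth t i \in <<X i>>%VS) -> a t = 0.
Proof.
move=> ml aX t0 Xt0.
suff : forall q t, (forall i : 'I_m, if (i < q)%N then tnth t i \in <<X i>>%VS
    else tnth t i \in X i) -> a t = 0.
  by move/(_ m t0); apply=> i; rewrite ltn_ord.
elim=> [|q IH] t Xt; first by apply: aX => i; exact: (Xt i).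
have [qm|mq] := ltnP q m; last first.
  apply: IH => i; have iq := leq_trans (ltn_ord i) mq.
  by have := Xt i; rewrite iq ltnS ltnW.
pose i0 := Ordinal qm; have [g hg] := multilinear_covector t i0 ml.
have sub : (<<X i0>> <= lker g)%VS.
  apply/span_subvP => w wX; rewrite memv_ker hg; apply/eqP; apply: IH => i.
  rewrite tnth_mktuple; have [->|ni] := eqVneq i i0; first by rewrite ltnn.
  have := Xt i; rewrite ltnS leq_eqVlt; case: eqP => // e.
  by move: ni; rewrite -val_eqE /= e eqxx.
have := Xt i0; rewrite ltnSn => /(subvP sub).
by rewrite memv_ker hg subst_at_id => /eqP.
Qed.

Lemma multilinear_telescope m (a : cochain W m) (t u : m.-tuple W) :
  multilinear a ->
  a u - a t = \sum_(q < m) a [tuple if (j < q)%N then tnth u j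
    else if j == q then tnth u j - tnth t j else tnth t j | j < m].
Proof.
move=> ml; pose h q := [tuple if (j < q)%N then tnth u j else tnth t j | j < m].
have -> : a u - a t = a (h m) - a (h 0%N).
  by congr (a _ - a _); apply: eq_from_tnth => j; rewrite tnth_mktuple ?ltn_ord.
rewrite -(telescope_sumr (fun q => a (h q))) // big_mkord.
apply: eq_bigr => q _; have [g hg] := multilinear_covector (h q) q ml.
have -> : a (h q.+1) = g (tnth u q).
  rewrite hg; congr a; apply: eq_from_tnth => j; rewrite !tnth_mktuple ltnS leq_eqVlt.
  by rewrite -val_eqE /=; case: eqP => // e; congr (tnth u _); apply: val_inj.
have -> : a (h q) = g (tnth t q).
  rewrite hg; congr a; apply: eq_from_tnth => j; rewrite !tnth_mktuple.
  by case: eqP => // ->; rewrite ltnn.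
transitivity (g (tnth u q - tnth t q)); first by rewrite linearB.
rewrite hg; congr a; apply: eq_from_tnth => j; rewrite !tnth_mktuple.
by case: eqP => // ->; rewrite ltnn.
Qed.

Lemma ext_dual_sign m (a : cochain W m) : ext_dual a -> sign_symmetric a.
Proof.
move=> [ml alt] s.
have [ts -> /allP dts] := prod_tpermP s.
elim: ts dts => [|[i j] ts IH] dts B.
  rewrite big_nil odd_perm1 mul1r; congr a.
  by apply: eq_from_tnth => l; rewrite tnth_mktuple perm1.
have {IH}IH := IH (fun p hp => dts p (@mem_behead _ (_ :: _) _ hp)).
have ij : i != j by have := dts (i, j); rewrite mem_head => /(_ isT).
set p := (\prod_(t <- ts) _)%g in IH.
have -> : permute (\prod_(t <- (i, j) :: ts) tperm t.1 t.2)%g B =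
    permute (tperm i j) (permute p B).
  by apply: eq_from_tnth => l; rewrite big_cons !tnth_mktuple permM.
rewrite big_cons odd_permM -/p odd_tperm ij signr_addb mulN1r mulNr -IH.
set t := permute p B; pose F x y := a (subst_at (subst_at t i x) j y).
have F0 x : F x x = 0.
  by apply: (alt _ _ _ ij); rewrite !tnth_mktuple (negbTE ij) !eqxx.
have Dr x y z : F x (y + z) = F x y + F x z.
  by rewrite /F -[y in LHS]scale1r ml mul1r.
have Dl x y z : F (y + z) x = F y x + F z x.
  have sw u : subst_at (subst_at t i u) j x = subst_at (subst_at t j x) i u.
    apply: eq_from_tnth => l; rewrite !tnth_mktuple.
    by have [->|//] := eqVneq l j; rewrite eq_sym (negbTE ij).
  by rewrite /F !sw -[y in LHS]scale1r ml mul1r.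
have := F0 (tnth t i + tnth t j).
rewrite Dr !Dl !F0 add0r addr0 addrC => /eqP; rewrite addr_eq0 => /eqP e.
have <- : F (tnth t i) (tnth t j) = a t.
  by rewrite /F subst_at_id -[RHS](congr1 a (subst_at_id t j)).
rewrite e opprK; congr a; apply: eq_from_tnth => l; rewrite !tnth_mktuple.
by case: tpermP => [->|->|/eqP/negbTE-> /eqP/negbTE->] //; rewrite ?eqxx // (negbTE ij).
Qed.

Lemma killed_by0 (V : {vspace W}) j m : killed_by V j ((fun=> 0) : cochain W m).
Proof. by elim: j m => [|j IH] [|m] //= v _; exact: IH. Qed.

Lemma killed_byP (V : {vspace W}) j m (a : cochain W m) : killed_by V j a <->
  forall t : m.-tuple W, (j <= m)%N -> {subset take j t <= V} -> a t = 0.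
Proof.
elim: j m a => [|j IH] m a.
  by split=> [-> //|a0]; apply/funext => t; apply: a0 => //; rewrite take0.
case: m a => [|m] a; first by split=> // _ v _; exact: killed_by0.
split=> [ka t|ka v Vv].
  case/tupleP: t => v t jm Vt.
  have Vv : v \in V by apply: Vt; rewrite /= mem_head.
  have /IH /(_ t jm) := ka v Vv; apply=> w wt.
  by apply: Vt; rewrite /= inE wt orbT.
apply/IH => t jm Vt; apply: ka => // w; rewrite /= inE => /orP[/eqP->//|].
exact: Vt.
Qed.

Lemma ext_dual_perm_eq0 m (a : cochain W m) (t u : m.-tuple W) :
  ext_dual a -> perm_eq t u -> a t = 0 -> a u = 0.
Proof.
move=> Aa /tuple_permP [s ts] at0.
have e : t = permute s u by apply: val_inj.
by move/eqP: at0; rewrite e ext_dual_sign // mulf_eq0 signr_eq0 => /eqP.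
Qed.

Lemma killed_by_count (V : {vspace W}) j m (a : cochain W m) (t : m.-tuple W) :
  ext_dual a -> killed_by V j a -> (j <= count (mem V) t)%N -> a t = 0.
Proof.
move=> Aa /killed_byP ka jt.
have p : perm_eq ([seq w <- t | w \in V] ++ [seq w <- t | w \notin V]) t.
  by rewrite (perm_filterC (mem V)).
have sz : size ([seq w <- t | w \in V] ++ [seq w <- t | w \notin V]) == m.
  by rewrite (perm_size p) size_tuple.
apply: (@ext_dual_perm_eq0 _ _ (Tuple sz)) => //; apply: ka => [|w].
  by rewrite (leq_trans jt) // -[X in (_ <= X)%N](size_tuple t) count_size.
rewrite takel_cat ?size_filter // => /mem_take.
by rewrite mem_filter => /andP[].
Qed.

Lemma interior_ext_dual m w (a : cochain W m.+1) :
  ext_dual a -> ext_dual (interior w a).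
Proof.
move=> [ml alt]; split=> [t i c u v|t i j ij tij] /=.
  have e x : [tuple of w :: subst_at t i x] =
      subst_at [tuple of w :: t] (lift ord0 i) x.
    apply: eq_from_tnth => l; rewrite tnth_mktuple.
    by case: (unliftP ord0 l) => [l' ->|->]; rewrite ?tnthS ?tnth_mktuple.
  by rewrite !e ml.
by apply: (alt _ (lift ord0 i) (lift ord0 j)); rewrite ?tnthS // (inj_eq lift_inj).
Qed.

Lemma ext_dual_catl p q (a : cochain W (p + q)) (u : q.-tuple W) :
  ext_dual a -> ext_dual (fun t : p.-tuple W => a [tuple of t ++ u]).
Proof.
move=> [ml alt]; split=> [t i c v w|t i j ij tij] /=.
  have e x : [tuple of subst_at t i x ++ u] =
      subst_at [tuple of t ++ u] (lshift q i) x.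
    apply: eq_from_tnth => l; rewrite tnth_mktuple.
    case: (splitP l) => l' el.
      have -> : l = lshift q l' by apply: val_inj.
      by rewrite !tnth_lshift tnth_mktuple (inj_eq (@lshift_inj _ _)).
    have -> : l = rshift p l' by apply: val_inj.
    by rewrite !tnth_rshift -val_eqE /= gtn_eqF // ltn_addr.
  by rewrite !e ml.
by apply: (alt _ (lshift q i) (lshift q j)); rewrite ?tnth_lshift.
Qed.

Lemma ext_dual_catr p q (a : cochain W (p + q)) (u : p.-tuple W) :
  ext_dual a -> ext_dual (fun t : q.-tuple W => a [tuple of u ++ t]).
Proof.
move=> [ml alt]; split=> [t i c v w|t i j ij tij] /=.
  have e x : [tuple of u ++ subst_at t i x] =
      subst_at [tuple of u ++ t] (rshift p i) x.
    apply: eq_from_tnth => l; rewrite tnth_mktuple.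
    case: (splitP l) => l' el.
      have -> : l = lshift q l' by apply: val_inj.
      by rewrite !tnth_lshift -val_eqE /= ltn_eqF // ltn_addr.
    have -> : l = rshift p l' by apply: val_inj.
    by rewrite !tnth_rshift tnth_mktuple (inj_eq (@rshift_inj _ _)).
  by rewrite !e ml.
by apply: (alt _ (rshift p i) (rshift p j));
  rewrite ?tnth_rshift ?(inj_eq (@rshift_inj _ _)).
Qed.

Lemma wedge_ext_dual m (f : seq (covector W)) : ext_dual (wedge f : cochain W m).
Proof.
split=> [t i c u v|t i j ij tij]; last first.
  rewrite /wedge -det_tr; apply: (determinant_alternate ij) => l.
  by rewrite !mxE tij.
rewrite /wedge -!(det_tr (\matrix_(_, _) _)).
rewrite (@determinant_multilinear _ _ _
  (\matrix_(l, j) f`_l (tnth (subst_at t i u) j))^T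
  (\matrix_(l, j) f`_l (tnth (subst_at t i v) j))^T i c 1) ?mul1r //.
- by apply/rowP=> j; rewrite !mxE !tnth_mktuple eqxx linearP mul1r.
- by apply/matrixP=> j l; rewrite !mxE !tnth_mktuple eq_sym (negbTE (neq_lift _ _)).
- by apply/matrixP=> j l; rewrite !mxE !tnth_mktuple eq_sym (negbTE (neq_lift _ _)).
Qed.

Lemma ext_dualD m (a b : cochain W m) :
  ext_dual a -> ext_dual b -> ext_dual (fun t => a t + b t).
Proof.
move=> [mla alta] [mlb altb]; split=> [t i c u v|t i j ij tij].
  by rewrite mla mlb mulrDr addrACA.
by rewrite (alta _ i j) // (altb _ i j) // addr0.
Qed.

Lemma ext_dualZ m (c : R) (a : cochain W m) :
  ext_dual a -> ext_dual (fun t => c * a t).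
Proof.
move=> [ml alt]; split=> [t i d u v|t i j ij tij].
  by rewrite ml mulrDr mulrCA.
by rewrite (alt _ i j) // mulr0.
Qed.

Lemma ext_dual_sum m (I : Type) (s : seq I) (F : I -> cochain W m) :
  (forall i, ext_dual (F i)) -> ext_dual (fun t => \sum_(i <- s) F i t).
Proof.
move=> AF; elim: s => [|i s IH].
  by split=> [t j c u v|t j l _ _]; rewrite !big_nil // mulr0 addr0.
rewrite (_ : (fun _ => _) = fun t => F i t + \sum_(i <- s) F i t).
  exact: ext_dualD.
by apply/funext => t; rewrite big_cons.
Qed.

Lemma ext_power_ext_dual (A : set (covector W)) m (a : cochain W m) :
  ext_power A a -> ext_dual a.
Proof.
move=> [p [c [f [_ ->]]]]; apply: ext_dual_sum => j.
exact/ext_dualZ/wedge_ext_dual.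
Qed.

Lemma wedge_cons m (g : covector W) (f : seq (covector W)) (t : m.+1.-tuple W) :
  wedge (g :: f) t = \sum_(j < m.+1) (-1) ^+ j * g (tnth t j) *
     wedge f [tuple tnth t (lift j i) | i < m].
Proof.
rewrite /wedge (expand_det_row _ ord0); apply: eq_bigr => j _.
rewrite mxE /cofactor add0n mulrCA mulrA; congr (_ * \det _).
by apply/matrixP => i l; rewrite !mxE tnth_mktuple.
Qed.

Definition tuple_front (T : Type) m (j : 'I_m.+1) (t : m.+1.-tuple T) :
    m.+1.-tuple T :=
  [tuple of tnth t j :: [tuple tnth t (lift j i) | i < m]].

Lemma tuple_frontE (T : Type) m (j : 'I_m.+1) (t : m.+1.-tuple T) :
  tuple_front j t = permute (lift_perm ord0 j 1) t.
Proof.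
apply: eq_from_tnth => i; rewrite tnth_mktuple.
case: (unliftP ord0 i) => [i' ->|->]; last by rewrite lift_perm_id.
by rewrite tnthS tnth_mktuple lift_perm_lift perm1.
Qed.

Lemma flat_tuple_front m (a : cochain W m.+1) t (j : 'I_m.+1) : ext_dual a ->
  flat a (tnth t j) [tuple tnth t (lift j i) | i < m] = (-1) ^+ j * a t.
Proof.
move=> Aa; transitivity (a (tuple_front j t)) => //.
by rewrite tuple_frontE ext_dual_sign // odd_lift_perm odd_perm1 addbF signr_odd.
Qed.

End MultilinearForms.

(** * Determinants of Kronecker deltas *)

Section DeltaDeterminant.
Context {R : comNzRingType}.

Definition delta_det (A : eqType) m (D B : m.-tuple A) : R :=
  \det (\matrix_(i < m, j < m) (tnth D i == tnth B j)%:R).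

Lemma delta_detE (A : eqType) m (D B : m.-tuple A) :
  delta_det D B = \sum_(s : 'S_m) (-1) ^+ s * (D == permute s B)%:R.
Proof.
apply: eq_bigr => s _; congr (_ * _).
under eq_bigr do rewrite mxE.
case: (pickP (fun i => tnth D i != tnth B (s i))) => [i ne|eqDB].
  rewrite (bigD1 i) //= (negbTE ne) mul0r; case: eqP => // e.
  by rewrite e tnth_mktuple eqxx in ne.
rewrite big1 => [|i _]; last by have /negbFE -> := eqDB i.
case: eqP => // -[]; apply: eq_from_tnth => i.
by rewrite tnth_mktuple; apply/eqP/negbFE/eqDB.
Qed.

Lemma sum_delta_det (A : finType) m (g : m.-tuple A -> R) B0 :
  sign_symmetric g -> \sum_B g B * delta_det B B0 = (m`!)%:R * g B0.
Proof.
move=> sg; under eq_bigr do rewrite delta_detE mulr_sumr.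
rewrite exchange_big /= (eq_bigr (fun=> g B0)) => [|s _].
  by rewrite sumr_const card_Sn mulr_natl.
rewrite (bigD1 (permute s B0)) //= eqxx mulr1 sg big1 => [|B /negbTE ->].
  by rewrite addr0 mulrAC -signr_addb addbb mul1r.
by rewrite !mulr0.
Qed.

Lemma delta_det_perm (A : eqType) m (D B : m.-tuple A) :
  delta_det D B != 0 -> perm_eq D B.
Proof.
apply: contraNT => np; rewrite delta_detE big1 // => s _.
case: eqP => [e|]; last by rewrite mulr0.
by case/negP: np; apply/tuple_permP; exists s; rewrite {1}e.
Qed.

Lemma delta_det_diag (A : eqType) m (D : m.-tuple A) :
  uniq D -> delta_det D D = 1.
Proof.
move=> uD; rewrite -[RHS](det1 R m); congr determinant.
apply/matrixP=> i j; rewrite !mxE.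
by rewrite -val_eqE (inj_eq (tuple_uniqP _ uD)).
Qed.

Lemma delta_det_cat (A1 A2 : eqType) p q (J J0 : p.-tuple A1) (M M0 : q.-tuple A2) :
  delta_det [tuple of map inl J ++ map inr M] [tuple of map inl J0 ++ map inr M0]
  = delta_det J J0 * delta_det M M0.
Proof.
rewrite /delta_det -(det_ublock _ 0 _); congr determinant.
apply/matrixP => i j; rewrite !mxE.
case: (splitP i) => i' ei; rewrite !mxE; case: (splitP j) => j' ej; rewrite !mxE.
- have -> : i = lshift q i' by apply: val_inj.
  have -> : j = lshift q j' by apply: val_inj.
  by rewrite !tnth_lshift !tnth_map.
- have -> : i = lshift q i' by apply: val_inj.
  have -> : j = rshift p j' by apply: val_inj.
  by rewrite tnth_lshift tnth_rshift !tnth_map.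
- have -> : i = rshift p i' by apply: val_inj.
  have -> : j = lshift q j' by apply: val_inj.
  by rewrite tnth_lshift tnth_rshift !tnth_map.
- have -> : i = rshift p i' by apply: val_inj.
  have -> : j = rshift p j' by apply: val_inj.
  by rewrite !tnth_rshift !tnth_map.
Qed.

End DeltaDeterminant.

(** * Frames adapted to a flag of subspaces *)

Definition is_inl (A B : Type) (a : A + B) : bool := if a is inl _ then true else false.

Record adapted_frame (R : realType) (W : vectType R) (N n : nat)
    (L V : {vspace W}) (c : 'I_N + 'I_n -> W) (x : 'I_N + 'I_n -> covector W)
    : Prop := AdaptedFrame {
  frame_sub : (L <= V)%VS;
  frame_dual : forall a b, x a (c b) = (a == b)%:R;
  frame_annih : forall a l, l \in L -> x a l = 0;
  frame_decomp : forall w, w - \sum_a x a w *: c a \in L;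
  frame_vert : forall i, c (inl i) \in V;
  frame_hor : forall mu v, v \in V -> x (inr mu) v = 0 }.

Definition vanishes_on (R : realType) (W : vectType R) (L : {vspace W}) m
    (a : cochain W m) := forall (t : m.-tuple W) i, tnth t i \in L -> a t = 0.

Lemma map_permute (T U : Type) (f : T -> U) m (s : 'S_m) (B : m.-tuple T) :
  map_tuple f (permute s B) = permute s (map_tuple f B).
Proof. by apply: eq_from_tnth => i; rewrite !(tnth_map, tnth_mktuple). Qed.

Lemma wedge_vanishes_on (R : realType) (W : vectType R) (L : {vspace W}) m
  (f : seq (covector W)) : (forall g, g \in f -> forall l, l \in L -> g l = 0) ->
  vanishes_on L (wedge f : cochain W m).
Proof.
move=> fL t i Lti; rewrite /wedge (expand_det_col _ i) big1 // => j _.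
rewrite mxE; have [jf|fj] := ltnP j (size f).
  by rewrite (fL _ (mem_nth 0 jf)) // mul0r.
by rewrite nth_default // lfunE mul0r.
Qed.

Lemma ext_power_vanishes_on (R : realType) (W : vectType R) (L : {vspace W}) m
  (a : cochain W m) : ext_power (annihilator L) a -> vanishes_on L a.
Proof.
move=> [p [c [f [Lf ->]]]] t i Lti; rewrite big1 // => j _.
rewrite (wedge_vanishes_on (L := L) _ Lti) ?mulr0 // => g /tnthP[l ->].
exact: Lf.
Qed.

Section AdaptedFrame.
Context {R : realType} {W : vectType R} {N n : nat}.
Local Notation A := ('I_N + 'I_n)%type.
Context {L V : {vspace W}} {c : A -> W} {x : A -> covector W}.
Hypothesis F : adapted_frame L V c x.

Lemma frame_span (P : pred A) w : (forall a, ~~ P a -> x a w = 0) ->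
  w \in <<vbasis L ++ [seq c b | b <- enum P]>>%VS.
Proof.
move=> xw; rewrite span_cat (span_basis (vbasisP L)).
rewrite -(subrK (\sum_a x a w *: c a) w) memv_add ?(frame_decomp F) //.
apply: memv_suml => a _; have [Pa|nPa] := boolP (P a); last first.
  by rewrite xw // scale0r mem0v.
by rewrite memvZ // memv_span // map_f // mem_enum.
Qed.

Lemma frame_eq0_on m (a : cochain W m) (P : 'I_m -> pred A) :
  multilinear a -> vanishes_on L a ->
  (forall B : m.-tuple A, (forall i, P i (tnth B i)) -> a (map_tuple c B) = 0) ->
  forall t : m.-tuple W, (forall i b, ~~ P i b -> x b (tnth t i) = 0) -> a t = 0.
Proof.
move=> ml La aB t Pt.
apply: (multilinear_eq0 ml) (fun i => frame_span (Pt i)) => {Pt}t Xt.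
have [/existsP[i Lti]|/existsPn nL] := boolP [exists i, tnth t i \in L].
  exact: La Lti.
have /choice[b hb] i : exists b, P i b /\ tnth t i = c b.
  have := Xt i; rewrite mem_cat => /orP[/vbasis_mem|].
    by rewrite (negbTE (nL i)).
  by case/mapP => b; rewrite mem_enum => Pb e; exists b.
have -> : t = map_tuple c [tuple b i | i < m].
  by apply: eq_from_tnth => i; rewrite tnth_map tnth_mktuple; case: (hb i).
by apply: aB => i; rewrite tnth_mktuple; case: (hb i).
Qed.

Lemma frame_eq0 m (a : cochain W m) : multilinear a ->
  (forall t i, tnth t i \in L ->
    (forall j, tnth t j \in L \/ exists b, tnth t j = c b) -> a t = 0) ->
  (forall B : m.-tuple A, a (map_tuple c B) = 0) -> forall t, a t = 0.
Proof.
move=> ml La aB t.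
have Xt i := @frame_span xpredT (tnth t i) (fun _ => ltac:(done)).
apply: (multilinear_eq0 ml _ Xt) => {Xt}t Xt.
have {}Xt j : tnth t j \in L \/ exists b, tnth t j = c b.
  have := Xt j; rewrite mem_cat => /orP[/vbasis_mem|]; first by left.
  by case/mapP => b _ e; right; exists b.
have [/existsP[i Lti]|/existsPn nL] := boolP [exists i, tnth t i \in L].
  exact: La Lti Xt.
have /choice[b hb] i : exists b, tnth t i = c b.
  by have [Li|//] := Xt i; case/negP: (nL i).
have -> : t = map_tuple c [tuple b i | i < m].
  by apply: eq_from_tnth => i; rewrite tnth_map tnth_mktuple.
exact: aB.
Qed.

Lemma frame_eq0_rel m (a : cochain W m) : multilinear a -> vanishes_on L a ->
  (forall B : m.-tuple A, a (map_tuple c B) = 0) -> forall t, a t = 0.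
Proof.
by move=> ml La aB t; apply: (@frame_eq0_on m a (fun _ => xpredT)) => // B _.
Qed.

Lemma frame_killed_by r m (a : cochain W m) : multilinear a -> vanishes_on L a ->
  (forall B : m.-tuple A, (r <= count (@is_inl _ _) B)%N -> a (map_tuple c B) = 0) ->
  killed_by V r a.
Proof.
move=> ml La aB; apply/killed_byP => t rm Vt.
pose P (i : 'I_m) (b : A) := (i < r)%N ==> is_inl b.
apply: (@frame_eq0_on m a P) => // [B PB|i [b|mu]]; rewrite /P ?implybT //.
  apply: aB; rewrite -(cat_take_drop r B) count_cat.
  apply: leq_trans (leq_addr _ _).
  suff : all (@is_inl _ _) (take r B).
    by rewrite all_count => /eqP ->; rewrite size_takel ?size_tuple.
  apply/allP => b /(nthP b) [i].
  rewrite size_takel ?size_tuple // => ir <-; rewrite nth_take //.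
  have im : (i < m)%N by exact: leq_trans ir rm.
  by have := PB (Ordinal im); rewrite (tnth_nth b) /P /= ir.
rewrite implybF negbK => ir; apply: (frame_hor F); apply: Vt.
rewrite (tnth_nth 0) -(nth_take 0 ir) mem_nth //.
by rewrite size_takel ?size_tuple.
Qed.

Lemma wedge_frame m (D : seq A) (D' B : m.-tuple A) : D = D' ->
  wedge (map x D) (map_tuple c B) = delta_det D' B :> R.
Proof.
move=> ->; congr determinant; apply/matrixP => i j; rewrite !mxE.
rewrite (nth_map (tnth D' i)) ?size_tuple // tnth_map (frame_dual F).
by rewrite -tnth_nth.
Qed.

Lemma frame_sign m (a : cochain W m) : ext_dual a ->
  sign_symmetric (fun B : m.-tuple A => a (map_tuple c B)).
Proof. by move=> Aa s B; rewrite map_permute ext_dual_sign. Qed.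

Lemma delta_det_sign m (D : m.-tuple A) :
  sign_symmetric (fun B => delta_det D B : R).
Proof.
move=> s B; rewrite -!(wedge_frame _ (erefl (tval D))).
exact: (frame_sign (wedge_ext_dual _ _)).
Qed.

Lemma frame_count_vert r m (a : cochain W m) (B : m.-tuple A) :
  ext_dual a -> killed_by V r a -> (r <= count (@is_inl _ _) B)%N ->
  a (map_tuple c B) = 0.
Proof.
move=> Aa ka rB; apply: killed_by_count ka _ => //; apply: leq_trans rB _.
rewrite count_map; apply: sub_count => -[i _|//].
exact: frame_vert F i.
Qed.

Lemma ext_power_prescribed m (g : m.-tuple A -> R) : sign_symmetric g ->
  exists2 a : cochain W m, ext_power (annihilator L) a &
    forall B, a (map_tuple c B) = g B.
Proof.
move=> sg; pose co (B : m.-tuple A) := (m`!)%:R^-1 * g B.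
exists (fun t => \sum_(B : m.-tuple A) co B * wedge (map x B) t).
  exists #|{: m.-tuple A}|, (fun j => co (enum_val j)), (fun j => map_tuple x (enum_val j)).
  split=> [j i l Ll|]; first by rewrite tnth_map (frame_annih F).
  apply/funext => t.
  exact: (big_enum_val (A := predT) (fun B : m.-tuple A => co B * wedge (map x B) t)).
move=> B; rewrite /co; under eq_bigr do rewrite -mulrA.
rewrite -mulr_sumr (eq_bigr (fun D => g D * delta_det D B)) => [|D _].
  by rewrite sum_delta_det // mulKf // pnatr_eq0 -lt0n fact_gt0.
by rewrite (wedge_frame _ (erefl (tval D))).
Qed.

Lemma frame_not_uniq m (a : cochain W m) (B : m.-tuple A) : ext_dual a ->
  ~~ uniq B -> a (map_tuple c B) = 0.
Proof.
move=> [_ alt] nB; have : ~~ injectiveb (tnth B).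
  by apply: contra nB => /injectiveP /tuple_uniqP.
by case/injectivePn => i [j ij e]; apply: (alt _ i j) => //; rewrite !tnth_map e.
Qed.

Definition multi_index (J : seq 'I_N) (M : seq 'I_n) : seq A :=
  map inl J ++ map inr M.

Lemma size_multi_index J M : size (multi_index J M) = (size J + size M)%N.
Proof. by rewrite size_cat !size_map. Qed.

Lemma count_multi_index J M : count (@is_inl _ _) (multi_index J M) = size J.
Proof.
rewrite count_cat !count_map (eq_count (a2 := predT)) // count_predT.
by rewrite (eq_count (a2 := pred0)) // count_pred0 addn0.
Qed.

Lemma perm_multi_index (B : seq A) : exists J M, perm_eq B (multi_index J M).
Proof.
elim: B => [|[i|mu] B [J [M BJM]]]; first by exists [::], [::].
  by exists (i :: J), M; rewrite /= perm_cons.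
exists J, (mu :: M); rewrite perm_sym /multi_index /= perm_catC /= perm_cons.
by rewrite perm_catC perm_sym.
Qed.

Lemma multi_index_perm_eq J M J' M' :
  perm_eq (multi_index J M) (multi_index J' M') -> perm_eq J J' /\ perm_eq M M'.
Proof.
have fl J1 M1 : filter (@is_inl _ _) (multi_index J1 M1) = map inl J1.
  by elim: J1 => [|j J1 /= ->] //; elim: M1.
have fr J1 M1 : filter (predC (@is_inl _ _)) (multi_index J1 M1) = map inr M1.
  by elim: J1 => //; elim: M1 => //= mu M1 ->.
move=> JM; split.
  have := perm_filter (@is_inl _ _) JM; rewrite !fl.
  by apply: perm_map_inj => i j [].
have := perm_filter (predC (@is_inl _ _)) JM; rewrite !fr.
by apply: perm_map_inj => i j [].
Qed.

(* Only meant for lists of length m. *)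
Definition eval_seq m (a : cochain W m) (s : seq W) : R := a [tuple s`_i | i < m].

Lemma eval_seq_tuple m (a : cochain W m) (t : m.-tuple W) : eval_seq a t = a t.
Proof.
by congr a; apply: eq_from_tnth => i; rewrite tnth_mktuple (tnth_nth 0).
Qed.

Lemma eval_seq_multi_index_sign p q m (a : cochain W m) (J : p.-tuple 'I_N)
    (M : q.-tuple 'I_n) (s : 'S_p) (u : 'S_q) : (p + q)%N = m -> ext_dual a ->
  eval_seq a (map c (multi_index (permute s J) (permute u M))) =
  (-1) ^+ s * (-1) ^+ u * eval_seq a (map c (multi_index J M)).
Proof.
move=> h; subst m => Aa.
have E (J' : p.-tuple 'I_N) (M' : q.-tuple 'I_n) :
    eval_seq a (map c (multi_index J' M')) =
    a [tuple of map_tuple (c \o inl) J' ++ map_tuple (c \o inr) M'].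
  by rewrite -eval_seq_tuple /= map_cat -!map_comp.
rewrite !E !map_permute (ext_dual_sign (ext_dual_catl _ Aa)) -mulrA.
by congr (_ * _); exact: (ext_dual_sign (ext_dual_catr _ Aa)).
Qed.

Lemma frame_expansion_term p q (a : cochain W (p + q))
    (J0 : p.-tuple 'I_N) (M0 : q.-tuple 'I_n) : ext_dual a ->
  \sum_(J : p.-tuple 'I_N) \sum_(M : q.-tuple 'I_n)
    eval_seq a (map c (multi_index J M)) *
    wedge (map x (multi_index J M))
      (map_tuple c [tuple of map inl J0 ++ map inr M0]) =
  (p`!)%:R * (q`!)%:R * a (map_tuple c [tuple of map inl J0 ++ map inr M0]).
Proof.
move=> Aa; pose G (J : p.-tuple 'I_N) (M : q.-tuple 'I_n) :=
  a [tuple of map_tuple (c \o inl) J ++ map_tuple (c \o inr) M].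
have GE (J : p.-tuple 'I_N) (M : q.-tuple 'I_n) :
    a (map_tuple c [tuple of map inl J ++ map inr M]) = G J M.
  by congr a; apply: val_inj; rewrite /= map_cat -!map_comp.
have sJ M : sign_symmetric (G^~ M).
  move=> s J; rewrite /G map_permute.
  exact: (ext_dual_sign (ext_dual_catl _ Aa)).
have sM J : sign_symmetric (G J).
  move=> s M; rewrite /G map_permute.
  exact: (ext_dual_sign (ext_dual_catr _ Aa)).
rewrite GE -mulrA -(sum_delta_det M0 (sM J0)) mulr_sumr.
under [RHS]eq_bigr do rewrite mulrA -(sum_delta_det J0 (sJ _)) mulr_suml.
rewrite exchange_big; apply: eq_bigr => M _; apply: eq_bigr => J _.
rewrite (wedge_frame (D' := [tuple of map inl J ++ map inr M])) //.
by rewrite delta_det_cat -GE -eval_seq_tuple mulrA.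
Qed.

Lemma frame_expansion r m (a : cochain W m) : ext_dual a -> vanishes_on L a ->
  killed_by V r a -> (r <= m.+1)%N -> forall t, a t =
  \sum_(s < r) (s`!)%:R^-1 * ((m - s)%N`!)%:R^-1 *
    \sum_(J : s.-tuple 'I_N) \sum_(M : (m - s)%N.-tuple 'I_n)
      eval_seq a (map c (multi_index J M)) * wedge (map x (multi_index J M)) t.
Proof.
move=> Aa La ka rm t; apply/eqP; rewrite -subr_eq0 -mulN1r; apply/eqP; move: t.
pose T s (t : m.-tuple W) := \sum_(J : s.-tuple 'I_N) \sum_(M : (m - s)%N.-tuple 'I_n)
  eval_seq a (map c (multi_index J M)) * wedge (map x (multi_index J M)) t.
pose rhs t := \sum_(s < r) (s`!)%:R^-1 * ((m - s)%N`!)%:R^-1 * T s t.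
pose b t := a t + -1 * rhs t.
suff : forall t, b t = 0 by [].
have Ab : ext_dual b.
  apply: ext_dualD => //; apply: ext_dualZ; apply: ext_dual_sum => s.
  apply: ext_dualZ; do 2![apply: ext_dual_sum => ?].
  exact/ext_dualZ/wedge_ext_dual.
apply: frame_eq0_rel => [|t i Lti|B]; first by case: Ab.
  rewrite /b (La _ i) // /rhs big1 ?mulr0 ?addr0 // => s _.
  rewrite /T big1 ?mulr0 // => J _.
  rewrite big1 // => M _; rewrite (wedge_vanishes_on (L := L) _ Lti) ?mulr0 //.
  by move=> g /mapP[d _ ->] l; exact: (frame_annih F).
have [J0 [M0 BJM]] := perm_multi_index B.
have m0 : m = (size J0 + size M0)%N.
  by rewrite -size_multi_index -(perm_size BJM) size_tuple.
pose B0 : m.-tuple A :=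
  tcast (esym m0) [tuple of map inl (in_tuple J0) ++ map inr (in_tuple M0)].
have B0E : B0 = multi_index J0 M0 :> seq A by rewrite val_tcast.
have Tn (s : nat) : (s <= m)%N -> s != size J0 -> T s (map_tuple c B0) = 0.
  move=> sm sJ; rewrite /T big1 // => J _; rewrite big1 // => M _.
  have sz : size (multi_index J M) == m by rewrite size_multi_index !size_tuple subnKC.
  rewrite (wedge_frame (D' := Tuple sz)) //; apply/eqP; rewrite mulf_eq0; apply/orP; right.
  apply: contraR sJ => /delta_det_perm /seq.permP /(_ (@is_inl _ _)).
  by rewrite /= B0E !count_multi_index size_tuple => ->.
apply: (@ext_dual_perm_eq0 _ _ _ _ (map_tuple c B0)) => //.
  by rewrite perm_map //= B0E perm_sym.
rewrite /b /rhs; have [J0r|rJ0] := ltnP (size J0) r; last first.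
  rewrite (frame_count_vert _ ka) ?B0E ?count_multi_index // add0r big1 ?mulr0 // => s _.
  rewrite Tn ?mulr0 //; first by rewrite -ltnS (leq_trans _ rm).
  by rewrite ltn_eqF // (leq_trans _ rJ0).
rewrite (bigD1 (Ordinal J0r)) //= [\sum_(i < r | _) _]big1 ?addr0 => [|s sJ]; last first.
  by rewrite Tn ?mulr0 // -ltnS (leq_trans _ rm).
suff -> : T (size J0) (map_tuple c B0) =
    ((size J0)`!)%:R * ((m - size J0)`!)%:R * a (map_tuple c B0).
  rewrite -invfM mulKf ?mulN1r ?subrr // -natrM pnatr_eq0.
  by rewrite muln_eq0 negb_or -!lt0n !fact_gt0.
rewrite /T /B0; clear -F m0 Aa; subst m.
rewrite tcast_id; move: (addKn (size J0) (size M0)).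
move: (size J0 + size M0 - size J0)%N => q e; subst q.
exact: frame_expansion_term.
Qed.

End AdaptedFrame.

(** * Increasing multi-indices *)

Lemma mem_increasing p s (J : seq 'I_p) :
  (J \in increasing p s) = (size J == s) && sorted ltn (map val J).
Proof.
rewrite mem_filter andbC; congr (_ && _); apply/mapP/eqP => [[t _ ->]|<-].
  exact: size_tuple.
by exists (in_tuple J) => //; rewrite mem_enum.
Qed.

Lemma increasing_uniq p s (J : seq 'I_p) : J \in increasing p s -> uniq J.
Proof.
rewrite mem_increasing ltn_sorted_uniq_leq => /andP[_ /andP[uJ _]].
exact: map_uniq uJ.
Qed.

Lemma increasing_perm_eq p s s' (J J' : seq 'I_p) :
  J \in increasing p s -> J' \in increasing p s' -> perm_eq J J' -> J = J'.
Proof.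
rewrite !mem_increasing => /andP[_ incJ] /andP[_ incJ'] JJ'.
apply: (inj_map val_inj); apply: (irr_sorted_eq ltn_trans ltnn incJ incJ') => i.
exact: (perm_mem (perm_map _ JJ')).
Qed.

Lemma uniq_perm_increasing p (J : seq 'I_p) : uniq J ->
  exists2 J', perm_eq J J' & J' \in increasing p (size J).
Proof.
move=> uJ; pose J' := sort (relpre val leq) J.
have JJ' : perm_eq J J' by rewrite perm_sym perm_sort.
exists J' => //; rewrite mem_increasing -(perm_size JJ') eqxx /=.
rewrite ltn_sorted_uniq_leq (map_inj_uniq val_inj) -(perm_uniq JJ') uJ /=.
by rewrite sorted_map sort_sorted // => i j; exact: leq_total.
Qed.

Lemma count_take_cat (T : Type) (p : pred T) (s1 s2 : seq T) m :
  count p s1 = 0%N -> (count p (take m (s1 ++ s2)) <= m - size s1)%N.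
Proof.
move=> s10; rewrite take_cat; case: ltnP => _.
  suff -> : count p (take m s1) = 0%N by [].
  apply/eqP; rewrite -leqn0 -s10.
  by rewrite -[X in (_ <= count _ X)%N](cat_take_drop m s1) count_cat leq_addr.
rewrite count_cat s10; apply: leq_trans (count_size _ _) _.
by rewrite size_take; case: ltnP => // /ltnW.
Qed.

Lemma few_inl_tuple N n r k (a : 'I_N + 'I_n) :
  (0 < r)%N -> (r = 1 -> N = 0)%N -> (k.+1 <= N + n)%N -> (k.+2 <= r + n)%N ->
  exists D : k.-tuple ('I_N + 'I_n),
    uniq (a :: D) /\ (count (@is_inl _ _) (a :: D) < r)%N.
Proof.
move=> r0 r1 kNn krn.
pose hs : seq ('I_N + 'I_n) := map inr (enum 'I_n).
pose vs : seq ('I_N + 'I_n) := map inl (enum 'I_N).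
have hs0 : count (@is_inl _ _) hs = 0%N.
  by rewrite count_map (eq_count (a2 := pred0)) ?count_pred0.
have sh : size hs = n by rewrite size_map size_enum_ord.
have sv : size vs = N by rewrite size_map size_enum_ord.
have uhv : uniq (hs ++ vs).
  rewrite cat_uniq; apply/and3P; split.
  - by rewrite map_inj_uniq ?enum_uniq // => i j [].
  - by apply/hasPn => _ /mapP[i _ ->]; apply/mapP => -[].
  - by rewrite map_inj_uniq ?enum_uniq // => i j [].
suff [s1 [s2 [u12 na s10 [sz le]]]] : exists s1 s2 : seq ('I_N + 'I_n),
    [/\ uniq (s1 ++ s2), a \notin s1 ++ s2, count (@is_inl _ _) s1 = 0%N &
     (k <= size (s1 ++ s2))%N /\ (is_inl a + (k - size s1) < r)%N].
  have sD : size (take k (s1 ++ s2)) == k by rewrite size_takel.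
  exists (Tuple sD); rewrite /= take_uniq // andbT; split.
    by apply: contra na => /mem_take.
  by apply: leq_ltn_trans le; rewrite leq_add2l count_take_cat.
case: a => [i|mu].
  exists hs, (rem (inl i) vs); rewrite cat_uniq !mem_cat !size_cat.
  have iv : inl i \in vs by rewrite map_f ?mem_enum.
  move: uhv; rewrite cat_uniq => /and3P[uh hv uv].
  have uv' : uniq (rem (inl i) vs) by exact: rem_uniq.
  rewrite size_rem // sh sv; split.
  - rewrite uh uv' andbT; apply: contra hv => /hasP[b /mem_rem bv bh].
    by apply/hasP; exists b.
  - rewrite negb_or; apply/andP; split; first by apply/mapP => -[].
    by rewrite mem_rem_uniqF.
  - by [].
  - by have := ltn_ord i; move: r1; rewrite /=; lia.
exists (rem (inr mu) hs), vs; rewrite cat_uniq !mem_cat !size_cat.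
have ih : inr mu \in hs by rewrite map_f ?mem_enum.
move: uhv; rewrite cat_uniq => /and3P[uh hv uv].
have uh' : uniq (rem (inr mu) hs) by exact: rem_uniq.
rewrite size_rem // sh sv; split.
- rewrite uv uh' andbT; apply: contra hv => /hasP[b bv /mem_rem bh].
  by apply/hasP; exists b.
- rewrite negb_or; apply/andP; split; last by apply/mapP => -[].
  by rewrite mem_rem_uniqF.
- apply/eqP; rewrite -leqn0 -hs0 count_rem; exact: leq_subr.
- by have := ltn_ord mu; rewrite /=; lia.
Qed.

(** * Multilagrangian forms *)

Lemma perm_eq_permute (A : eqType) m (s : 'S_m) (B : m.-tuple A) :
  perm_eq (permute s B) B.
Proof. by apply/tuple_permP; exists s. Qed.

Lemma vanishes_on_congr (R : realType) (W : vectType R) (L : {vspace W}) m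
  (a : cochain W m) (t u : m.-tuple W) : multilinear a -> vanishes_on L a ->
  (forall i, tnth u i - tnth t i \in L) -> a u = a t.
Proof.
move=> ml La ut; apply/eqP; rewrite -subr_eq0 multilinear_telescope // big1 // => q _.
by apply: (La _ q); rewrite tnth_mktuple ltnn eqxx.
Qed.

Section Multilagrangian.
Context {R : realType} {W : vectType R} {N n k r : nat}.
Local Notation A := ('I_N + 'I_n)%type.
Context {L V : {vspace W}} {omega : cochain W k.+1}.
Hypothesis Aomega : ext_dual omega.
Hypothesis Vomega : killed_by V r.+1 omega.
Hypothesis flatL : (flat omega @` [set l | l \in L] =
  @ext_power R W (annihilator L) k `&` @ext_dual_hor R W V k r.-1)%classic.
Hypothesis r_gt0 : (0 < r)%N.

Lemma flat_ext_dual w : ext_dual (flat omega w).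
Proof. exact: interior_ext_dual. Qed.

Lemma flat_vanishes_on l : l \in L -> vanishes_on L (flat omega l).
Proof.
move=> Ll; have : (flat omega @` [set l | l \in L])%classic (flat omega l).
  by exists l.
by rewrite flatL => -[/ext_power_vanishes_on].
Qed.

Lemma flat_prescribed (c : A -> W) (x : A -> covector W) (g : k.-tuple A -> R) :
  adapted_frame L V c x -> sign_symmetric g ->
  (forall B : k.-tuple A, (r <= count (@is_inl _ _) B)%N -> g B = 0) ->
  exists2 l, l \in L & forall B, flat omega l (map_tuple c B) = g B.
Proof.
move=> F sg g0; have [a Pa ag] := ext_power_prescribed F sg.
have : (flat omega @` [set l | l \in L])%classic a.
  rewrite flatL; split=> //; have Aa := ext_power_ext_dual Pa; split=> //.
  change (killed_by V r.-1.+1 a); rewrite prednK //.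
  have [ml _] := Aa; apply: (frame_killed_by F ml) => [|B rB].
    exact: ext_power_vanishes_on Pa.
  by rewrite ag g0.
by case=> l /= Ll la; exists l => // B; rewrite la ag.
Qed.

(* Adding to each frame vector an element of L changes [omega] on a tuple of
   frame vectors only to first order, L being isotropic.  The weights, which
   add up to 1 over a tuple, distribute the correction over its vertical
   entries when there are some: then it only involves forms of vertical degree
   less than r, which are those that can be prescribed. *)
Lemma frame_correction (c : A -> W) (x : A -> covector W) :
  adapted_frame L V c x ->
  exists2 c', adapted_frame L V c' x &
    forall B : k.+1.-tuple A, omega (map_tuple c' B) = 0.
Proof.
move=> F; pose wt (a : A) (v : nat) : R :=
  if v == 0%N then k.+1%:R^-1 else if is_inl a then v%:R^-1 else 0.
pose v (B : seq A) := count (@is_inl _ _) B.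
have /choice[h hh] a : exists l, l \in L /\ forall B : k.-tuple A,
    flat omega l (map_tuple c B) =
      - (wt a (v (a :: B)) * flat omega (c a) (map_tuple c B)).
  pose g (B : k.-tuple A) := - (wt a (v (a :: B)) * flat omega (c a) (map_tuple c B)).
  have sg : sign_symmetric g.
    move=> s B; rewrite /g; have -> : v (a :: permute s B) = v (a :: B).
      by rewrite /v /= (seq.permP (perm_eq_permute s B)).
    have := frame_sign (c := c) (flat_ext_dual (c a)) s B; rewrite /= => ->.
    by rewrite mulrN [in RHS]mulrCA.
  have [|l Ll hl] := flat_prescribed F sg; last by exists l.
  move=> B rB; rewrite /g; have [va|ha] := boolP (is_inl a).
    suff -> : flat omega (c a) (map_tuple c B) = 0 by rewrite mulr0 oppr0.
    have -> : flat omega (c a) (map_tuple c B) = omega (map_tuple c [tuple of a :: B]).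
      by congr omega; apply: val_inj.
    by apply: (frame_count_vert F Aomega Vomega); rewrite /= va.
  rewrite /wt /v /= (negbTE ha) add0n gtn_eqF ?mul0r ?oppr0 //.
  exact: leq_trans rB.
have hL a : h a \in L by case: (hh a).
exists (fun a => c a + h a) => [|B]; last first.
- set t := map_tuple c B; set u := map_tuple _ B.
  have ut i : tnth u i - tnth t i = h (tnth B i).
    by rewrite !tnth_map addrC addKr.
  have [ml _] := Aomega.
  have e : omega u - omega t = - (\sum_(q < k.+1) wt (tnth B q) (v B)) * omega t.
    rewrite multilinear_telescope // mulNr mulr_suml -sumrN; apply: eq_bigr => q _.
    set z := mktuple _.
    have zq : tnth z q = h (tnth B q) by rewrite tnth_mktuple ltnn eqxx ut.
    rewrite -[LHS](mulKr (unitrX q (unitrN1 _))) -flat_tuple_front // zq.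
    have [mlq _] := flat_ext_dual (h (tnth B q)).
    pose Bq := [tuple tnth B (lift q i) | i < k].
    rewrite (@vanishes_on_congr _ _ L _ _ (map_tuple c Bq) _ mlq).
    + have [_ ->] := hh (tnth B q).
      have -> : v (tnth B q :: Bq) = v B.
        have := perm_eq_permute (lift_perm ord0 q 1) B.
        by rewrite -tuple_frontE => /seq.permP; apply.
      have -> : flat omega (c (tnth B q)) (map_tuple c Bq) = (-1) ^+ q * omega t.
        rewrite -flat_tuple_front // tnth_map; congr flat.
        by apply: eq_from_tnth => i; rewrite tnth_map !tnth_mktuple tnth_map.
      by rewrite mulrN mulrCA mulKr // unitrX ?unitrN1.
    + exact: flat_vanishes_on.
    move=> i; rewrite [tnth (map_tuple c Bq) i]tnth_map !tnth_mktuple.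
    rewrite eq_sym (negbTE (neq_lift _ _)).
    have -> : c (tnth B (lift q i)) = tnth t (lift q i) by rewrite tnth_map.
    case: ifP => _; first by rewrite ut.
    by rewrite subrr mem0v.
  move/eqP: e; rewrite (_ : \sum_(q < k.+1) _ = 1) ?mulN1r.
    by rewrite subr_eq addNr => /eqP.
  rewrite /wt; case: eqP => [_|/eqP v0].
    by rewrite sumr_const card_ord -[LHS]mulr_natr mulVf // pnatr_eq0.
  rewrite -(big_tuple _ _ B xpredT (fun a => if is_inl a then (v B)%:R^-1 else 0)).
  rewrite -big_mkcond /= big_const_seq -/(v B) iter_addr_0 -[LHS]mulr_natr mulVf //.
  by rewrite pnatr_eq0.
- case: F => sub dual annih decomp vert hor; split=> // [a b|w|i].
  + by rewrite linearD /= dual annih ?addr0.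
  + under eq_bigr do rewrite scalerDr.
    by rewrite big_split opprD addrA /= memvB // memv_suml // => a _; rewrite memvZ.
  + by rewrite memvD // (subvP sub).
Qed.

Section CorrectedFrame.
Context {c : A -> W} {x : A -> covector W}.
Hypothesis F : adapted_frame L V c x.
Hypothesis omegac : forall B : k.+1.-tuple A, omega (map_tuple c B) = 0.

Lemma flat_frame b (B : k.-tuple A) : flat omega (c b) (map_tuple c B) = 0.
Proof.
apply: etrans (omegac [tuple of b :: B]).
by congr omega; apply: val_inj.
Qed.

Lemma frame_card_ge : omega <> (fun=> 0) -> (k <= N + n)%N.
Proof.
move=> nz; rewrite leqNgt; apply/negP => kNn; apply: nz; apply/funext.
have [ml _] := Aomega; apply: (frame_eq0 F) => // t i Li _.
apply/eqP; rewrite -(mulrI_eq0 _ (@lreg_sign _ i)) -flat_tuple_front //; apply/eqP.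
have [mli _] := flat_ext_dual (tnth t i).
apply: (frame_eq0_rel F) => // [|B]; first exact: flat_vanishes_on.
apply: frame_not_uniq; first exact: flat_ext_dual.
apply/negP => /card_uniqP; rewrite size_tuple => e.
have := max_card (mem B); rewrite e card_sum !card_ord.
by rewrite leqNgt kNn.
Qed.

Lemma delta_det_prescribed (D : k.-tuple A) :
  (count (@is_inl _ _) D < r)%N ->
  exists2 l, l \in L & forall B, flat omega l (map_tuple c B) = delta_det D B.
Proof.
move=> Dr; apply: (flat_prescribed F); first exact: (delta_det_sign F).
move=> B rB; apply/eqP; apply: contraTT Dr => /delta_det_perm /seq.permP ->.
by rewrite -leqNgt.
Qed.

Lemma form_ker_sub : omega <> (fun=> 0) -> (0 < k)%N -> (r = 1 -> N = 0)%N ->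
  (k.+1 <= r + n)%N -> forall w, form_ker omega w -> w \in L.
Proof.
move=> nz k0 r1 krn w wK; have kNn := frame_card_ge nz.
rewrite -[w](subrK (\sum_a x a w *: c a)) memvD ?(frame_decomp F) //.
rewrite big1 ?mem0v // => a _.
have kE : k.-1.+1 = k by rewrite prednK.
have [||D [uD Dr]] := @few_inl_tuple N n r k.-1 a r_gt0 r1; rewrite ?kE //.
have sD : size (a :: D) == k by rewrite /= size_tuple kE.
have [l Ll hl] := @delta_det_prescribed (Tuple sD) Dr.
have st v : size (v :: map c D) == k by rewrite /= size_map size_tuple kE.
have [mll _] := flat_ext_dual l.
have [g hg] := multilinear_covector (Tuple (st 0)) (Ordinal k0) mll.
have {}hg v : g v = flat omega l (Tuple (st v)).
  rewrite hg; congr (flat _ _ _); apply: eq_from_tnth => j.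
  by rewrite tnth_mktuple !(tnth_nth 0) -val_eqE /=; case: (val j).
have gL v : v \in L -> g v = 0.
  move=> Lv; rewrite hg; apply: (flat_vanishes_on Ll (i := Ordinal k0)).
  by rewrite (tnth_nth 0).
have gc b : g (c b) = (b == a)%:R.
  have sb : size (b :: D) == k by rewrite /= size_tuple kE.
  rewrite hg; have -> : Tuple (st (c b)) = map_tuple c (Tuple sb) by exact: val_inj.
  rewrite hl; have [e|ne] := eqVneq b a.
    subst b; rewrite (_ : Tuple sb = Tuple sD) ?delta_det_diag //.
    exact: val_inj.
  apply/eqP; apply: contraNT ne => /delta_det_perm /perm_mem /(_ a) /=.
  rewrite !inE eqxx /= => /esym/orP[|aD]; first by rewrite eq_sym.
  by move: uD; rewrite /= aD.
have gw : g w = x a w.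
  rewrite -[w in LHS](subrK (\sum_a x a w *: c a)) linearD /= gL ?(frame_decomp F) //.
  rewrite add0r linear_sum (bigD1 a) //= big1 => [|b ba]; last first.
    by rewrite linearZ /= gc (negbTE ba) scaler0.
  by rewrite linearZ /= gc eqxx addr0 /GRing.scale /= mulr1.
rewrite -gw hg; suff -> : flat omega l (Tuple (st w)) = 0 by rewrite scale0r.
set t := Tuple (st w); pose T := [tuple of l :: t].
have -> : flat omega l t = omega T by [].
pose i1 := lift ord0 (Ordinal k0); have T1 : tnth T i1 = w by rewrite tnthS (tnth_nth 0).
apply/eqP; rewrite -(mulrI_eq0 _ (@lreg_sign _ i1)) -flat_tuple_front // T1.
by move: wK; rewrite /form_ker /= => ->.
Qed.

Lemma dual_momenta : exists E' : seq 'I_N -> seq 'I_n -> covector W,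
  forall J M w, E' J M w = if (size J + size M == k)%N
    then eval_seq (flat omega w) (map c (multi_index J M)) else 0.
Proof.
suff /choice[E' hE'] : forall p : seq 'I_N * seq 'I_n, exists g : covector W,
    forall w, g w = if (size p.1 + size p.2 == k)%N
      then eval_seq (flat omega w) (map c (multi_index p.1 p.2)) else 0.
  by exists (fun J M => E' (J, M)) => J M w; rewrite hE'.
move=> [J M] /=; case: (_ == k); last by exists 0 => w; rewrite lfunE.
have [ml _] := Aomega.
pose t : k.-tuple W := [tuple (map c (multi_index J M))`_i | i < k].
have [g hg] := multilinear_covector [tuple of 0 :: t] ord0 ml.
exists g => w; rewrite hg; congr omega; apply: eq_from_tnth => i.
by rewrite tnth_mktuple; case: (unliftP ord0 i) => [j|] ->; rewrite ?tnthS.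
Qed.

Lemma basis_momenta : exists E : seq 'I_N -> seq 'I_n -> W, forall J M,
  (size J + size M = k)%N -> (size J < r)%N ->
  E J M \in L /\ forall B D : k.-tuple A, D = multi_index J M :> seq A ->
    flat omega (E J M) (map_tuple c B) = delta_det D B.
Proof.
suff /choice[E hE] : forall p : seq 'I_N * seq 'I_n, exists l,
    (size p.1 + size p.2 = k)%N -> (size p.1 < r)%N ->
    l \in L /\ forall B D : k.-tuple A, D = multi_index p.1 p.2 :> seq A ->
    flat omega l (map_tuple c B) = delta_det D B.
  by exists (fun J M => E (J, M)) => J M; exact: (hE (J, M)).
move=> [J M] /=;
have [/eqP sJM|/eqP nk] := boolP (size J + size M == k)%N; last by exists 0.
have [Jr|rJ] := ltnP (size J) r; last by exists 0.
have sD : size (multi_index J M) == k by rewrite size_multi_index sJM.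
have [|l Ll hl] := @delta_det_prescribed (Tuple sD).
  by rewrite /= count_multi_index.
exists l => _ _; split=> // B D DJM; rewrite hl; congr delta_det.
exact: val_inj.
Qed.

Section DualMomenta.
Context {E' : seq 'I_N -> seq 'I_n -> covector W}.
Hypothesis E'E : forall J M w, E' J M w = if (size J + size M == k)%N
    then eval_seq (flat omega w) (map c (multi_index J M)) else 0.

Lemma dual_momenta_frame J M b : E' J M (c b) = 0.
Proof.
rewrite E'E; case: eqP => // sJM.
have sB : size (multi_index J M) == k by rewrite size_multi_index sJM.
have -> : map c (multi_index J M) = map_tuple c (Tuple sB) by [].
by rewrite eval_seq_tuple flat_frame.
Qed.

Lemma dual_momenta_biantisymmetric : biantisymmetric E'.
Proof.
move=> p q J M s u; apply/lfunP => w; rewrite scale_lfunE !E'E !size_tuple.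
case: eqP => pq; last by rewrite scaler0.
rewrite (eval_seq_multi_index_sign _ _ _ _ pq) //; exact: flat_ext_dual.
Qed.

Lemma dual_momenta_eq0 u : u \in L ->
  (forall s J M, (s < r)%N -> (s <= k)%N -> J \in increasing N s ->
     M \in increasing n (k - s)%N -> E' J M u = 0) ->
  form_ker omega u.
Proof.
move=> Lu E'u; have Au := flat_ext_dual u; have [mlu _] := Au.
have Vu : u \in V by exact: (subvP (frame_sub F)).
apply/funext; apply: (frame_eq0_rel F) => // [|B]; first exact: flat_vanishes_on.
have [J [M BJM]] := perm_multi_index B.
have [uB|] := boolP (uniq B); last exact: frame_not_uniq.
have [rJ|Jr] := leqP r (size J).
  apply: (frame_count_vert F Au (Vomega Vu)).
  by move/seq.permP: BJM => ->; rewrite count_multi_index.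
move: (uB); rewrite (perm_uniq BJM) cat_uniq => /and3P[uJ _ uM].
have {uJ}[J' JJ' iJ'] := uniq_perm_increasing (map_uniq uJ).
have {uM}[M' MM' iM'] := uniq_perm_increasing (map_uniq uM).
have szk : (size J + size M = k)%N.
  by rewrite -size_multi_index -(perm_size BJM) size_tuple.
have sB' : size (multi_index J' M') == k.
  by rewrite size_multi_index -(perm_size JJ') -(perm_size MM') szk.
apply: (@ext_dual_perm_eq0 _ _ _ _ (map_tuple c (Tuple sB'))) => //.
  apply: perm_map; rewrite perm_sym (perm_trans BJM) // perm_cat //=; exact: perm_map.
have := E'u _ J' M' Jr; rewrite E'E -size_multi_index sB' -eval_seq_tuple; apply=> //.
  by rewrite -szk leq_addr.
by rewrite -szk addKn.
Qed.

Lemma omega_canonical_form : (r <= k.+1)%N ->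
  omega = canonical_form r (x \o inl) (x \o inr) E'.
Proof.
move=> rk; apply/funext => t; apply/eqP; rewrite -subr_eq0 -mulN1r; apply/eqP.
have Acan : ext_dual (canonical_form r (x \o inl) (x \o inr) E' : cochain W k.+1).
  apply: ext_dual_sum => s; apply: ext_dualZ; do 2![apply: ext_dual_sum => ?].
  exact: wedge_ext_dual.
have [ml _] := ext_dualD Aomega (ext_dualZ (-1) Acan); move: t.
pose S (w : W) (u : k.-tuple W) :=
  \sum_(s < r) (s`!)%:R^-1 * ((k - s)%N`!)%:R^-1 *
    \sum_(J : s.-tuple 'I_N) \sum_(M : (k - s)%N.-tuple 'I_n)
      E' J M w * wedge (map x (multi_index J M)) u.
have canE (t : k.+1.-tuple W) : canonical_form r (x \o inl) (x \o inr) E' t =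
    \sum_(j < k.+1) (-1) ^+ j * S (tnth t j) [tuple tnth t (lift j i) | i < k].
  under [RHS]eq_bigr do rewrite mulr_sumr.
  rewrite [RHS]exchange_big; apply: eq_bigr => s _ /=.
  under [RHS]eq_bigr do rewrite mulrCA.
  rewrite -mulr_sumr; congr (_ * _).
  under [RHS]eq_bigr do rewrite mulr_sumr.
  rewrite [RHS]exchange_big; apply: eq_bigr => J _ /=.
  under [RHS]eq_bigr do rewrite mulr_sumr.
  rewrite [RHS]exchange_big; apply: eq_bigr => M _ /=.
  have -> : [seq (x \o inl) i | i <- J] ++ [seq (x \o inr) mu | mu <- M] =
      map x (multi_index J M) by rewrite map_cat -!map_comp.
  by rewrite wedge_cons; apply: eq_bigr => j _; rewrite mulrA.
have Sc b u : S (c b) u = 0.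
  rewrite /S big1 // => s _; rewrite big1 ?mulr0 // => J _; rewrite big1 // => M _.
  by rewrite dual_momenta_frame mul0r.
have SL l u : l \in L -> S l u = flat omega l u.
  move=> Ll; have Vl : l \in V by exact: (subvP (frame_sub F)).
  rewrite (frame_expansion F (flat_ext_dual l) (flat_vanishes_on Ll) (Vomega Vl) rk).
  apply: eq_bigr => s _; congr (_ * _).
  apply: eq_bigr => J _; apply: eq_bigr => M _.
  by rewrite E'E !size_tuple subnKC ?eqxx // -ltnS (leq_trans _ rk).
apply: (frame_eq0 F) => // [t i Li Xt|B]; rewrite canE; last first.
  by rewrite omegac add0r big1 ?mulr0 // => j _; rewrite tnth_map Sc mulr0.
rewrite (bigD1 i) //= big1 => [|j ji].
  by rewrite SL // flat_tuple_front // signrMK addr0 mulN1r subrr.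
have [Lj|[b ->]] := Xt j; last by rewrite Sc mulr0.
have [i' ei _] := unlift_some ji.
by rewrite SL // (flat_vanishes_on Lj (i := i')) ?mulr0 // tnth_mktuple -ei.
Qed.

End DualMomenta.
End CorrectedFrame.
End Multilagrangian.

(** * Bases and dual families *)

Section DualFamilies.
Context {R : realType} {W : vectType R}.

Lemma complement_frame (U U' : {vspace W}) d :
  (U :&: U' = 0)%VS -> (U + U' = fullv)%VS -> \dim U = d ->
  exists (c : 'I_d -> W) (x : 'I_d -> covector W),
    [/\ forall i, c i \in U, forall i j, x i (c j) = (i == j)%:R,
      forall i u, u \in U' -> x i u = 0 &
      forall w, w - \sum_i x i w *: c i \in U'].
Proof.
move=> capU addU dU; subst d.
pose b := vbasis U; pose pU := daddv_pi U U'.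
exists (fun i => b`_i), (fun i => (linfun (coord b i : W -> R^o) \o pU)%VF).
have xE i w : (linfun (coord b i : W -> R^o) \o pU)%VF w = coord b i (pU w).
  by rewrite comp_lfunE lfunE.
have bU i : (i < \dim U)%N -> b`_i \in U.
  by move=> iU; rewrite vbasis_mem // mem_nth // size_tuple.
split=> [i|i j|i u U'u|w].
- exact: bU.
- rewrite xE /pU daddv_pi_id ?bU // coord_free ?(basis_free (vbasisP U)) //.
  by rewrite eq_sym.
- have := daddv_pi_add capU (_ : u \in (U + U')%VS).
  rewrite addU memvf => /(_ isT); rewrite (daddv_pi_id _ U'u) 1?capvC //.
  by move/(canRL (addrK _)); rewrite subrr xE /pU => ->; rewrite linear0.
- under eq_bigr do rewrite xE.
  rewrite -coord_vbasis ?memv_pi //.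
  have := daddv_pi_add capU (_ : w \in (U + U')%VS); rewrite addU memvf => /(_ isT).
  by move=> {1}<-; rewrite addrC addKr memv_pi.
Qed.

Lemma adapted_frame_exists (L V : {vspace W}) N n : (L <= V)%VS ->
  \dim V = (\dim L + N)%N -> \dim {:W} = (\dim V + n)%N ->
  exists (c : 'I_N + 'I_n -> W) (x : 'I_N + 'I_n -> covector W),
    adapted_frame L V c x.
Proof.
move=> LV dV dW; pose F := (V :\: L)%VS; pose H := (V^C)%VS.
have FL : (F :&: L = 0)%VS by exact: capv_diff.
have FLV : (F + L = V)%VS by rewrite addv_diff; apply/addv_idPl.
have HV : (H :&: V = 0)%VS by rewrite capvC capv_compl.
have HVW : (H + V = fullv)%VS by rewrite addvC addv_complf.
have FLH : (F :&: (L + H) = 0)%VS.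
  apply/eqP; rewrite -subv0; apply/subvP => f.
  rewrite memv_cap => /andP[Ff /memv_addP[l Ll [h Hh e]]].
  have Vf : f \in V by rewrite -FLV (subvP (addvSl F L)).
  have hE : h = f - l by rewrite e addrAC subrr add0r.
  have Vh : h \in V by rewrite hE memvB // (subvP LV).
  have h0 : h = 0 by apply/eqP; rewrite -memv0 -HV memv_cap Hh.
  by rewrite -FL memv_cap Ff e h0 addr0.
have FLHW : (F + (L + H) = fullv)%VS by rewrite addvA FLV addvC.
have dF : \dim F = N.
  by apply: (@addnI (\dim L)); rewrite -dV -FLV dimv_disjoint_sum // addnC.
have dH : \dim H = n.
  by apply: (@addnI (\dim V)); rewrite -dW -HVW dimv_disjoint_sum // addnC.
have [e [xe [Fe xee xe0 xeW]]] := complement_frame FLH FLHW dF.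
have [f [xf [Hf xff xf0 xfW]]] := complement_frame HV HVW dH.
have Ve i : e i \in V by rewrite -FLV (subvP (addvSl F L)).
exists (fun a => match a with inl i => e i | inr mu => f mu end).
exists (fun a => match a with inl i => xe i | inr mu => xf mu end).
split=> // [[i|mu] [j|nu]|[i|mu] l Ll|w].
- exact: xee.
- by rewrite xe0 // (subvP (addvSr L H)).
- by rewrite xf0.
- exact: xff.
- by rewrite xe0 // (subvP (addvSl L H)).
- by rewrite xf0 // (subvP LV).
rewrite big_sumType /=; set se := \sum_(i < N) _; set sf := \sum_(i < n) _.
have Fse : se \in F by apply: memv_suml => i _; rewrite memvZ.
have Hsf : sf \in H by apply: memv_suml => i _; rewrite memvZ.
have Vu : w - (se + sf) \in V.
  by rewrite opprD addrCA addrC memvB ?xfW // -FLV (subvP (addvSl F L)).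
have LHu : w - (se + sf) \in (L + H)%VS.
  by rewrite opprD addrA memvB ?xeW // (subvP (addvSr L H)).
move: Vu; rewrite -FLV => /memv_addP[g Fg [l Ll e']]; rewrite e'.
suff -> : g = 0 by rewrite add0r.
apply/eqP; rewrite -memv0 -FLH memv_cap Fg /=.
have -> : g = (w - (se + sf)) - l by rewrite e' addrK.
by apply: memvB => //; rewrite (subvP (addvSl L H)).
Qed.

Section Lists.
Context {I : eqType} {X : I -> W} {Y : I -> covector W}.

Lemma dual_family_span (s : seq I) (p : I) (w : W) : p \notin s ->
  {in s, forall q, Y p (X q) = 0} -> w \in <<map X s>>%VS -> Y p w = 0.
Proof.
move=> ps YX ws; apply/eqP; rewrite -memv_ker; apply: (subvP _ _ ws).
by apply/span_subvP => _ /mapP[q qs ->]; rewrite memv_ker YX.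
Qed.

Lemma dual_family_free (s : seq I) : uniq s ->
  {in s &, forall p q, Y p (X q) = (p == q)%:R} ->
  free (map X s) /\
  forall w, w \in <<map X s>>%VS -> {in s, forall p, Y p w = 0} -> w = 0.
Proof.
elim: s => [|p s IH] /=.
  by rewrite nil_free; split=> // w; rewrite span_nil memv0 => /eqP.
move=> /andP[ps us] dual.
have [|fs ws] := IH us; first by move=> q q' qs q's;
  apply: dual; rewrite inE ?qs ?q's orbT.
have dp : {in s, forall q, Y p (X q) = 0}.
  move=> q qs; rewrite dual ?mem_head ?inE ?qs ?orbT //.
  by case: eqP => // e; move: ps; rewrite e qs.
split=> [|w].
  rewrite free_cons fs andbT; apply/negP => /(dual_family_span ps dp) /eqP.
  by rewrite dual ?mem_head // eqxx oner_eq0.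
rewrite span_cons => /memv_addP[_ /vlineP[a ->] [w' sw' ->]] Yw.
have w'0 := dual_family_span ps dp sw'.
have a0 : a = 0.
  have := Yw p (mem_head _ _); rewrite linearD linearZ /= w'0 addr0.
  by rewrite dual ?mem_head // eqxx /GRing.scale /= mulr1.
rewrite a0 scale0r add0r; apply: ws => // q qs.
by have := Yw q; rewrite a0 scale0r add0r inE qs orbT; apply.
Qed.

Lemma dual_family_complement (s : seq I) (K : {vspace W}) : uniq s ->
  {in s &, forall p q, Y p (X q) = (p == q)%:R} ->
  (forall w, w \in K <-> {in s, forall p, Y p w = 0}) ->
  [/\ free (map X s), (<<map X s>> + K)%VS = fullv &
      (<<map X s>> :&: K)%VS = 0%VS].
Proof.
move=> us dual KE; have [fs s0] := dual_family_free us dual; split=> //.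
  apply/eqP; rewrite eqEsubv subvf; apply/subvP => w _.
  rewrite -[w](addrNK (\sum_(p <- s) Y p w *: X p)) addrC memv_add //.
    rewrite big_seq; apply: memv_suml => p ps.
    by rewrite memvZ // memv_span // map_f.
  apply/KE => q qs; rewrite linearB linear_sum /= (bigD1_seq q) //= linearZ /=.
  rewrite dual // eqxx big_seq_cond big1 => [|p /andP[ps pq]].
    by rewrite addr0 /GRing.scale /= mulr1 subrr.
  by rewrite linearZ /= dual // eq_sym (negbTE pq) scaler0.
apply/eqP; rewrite -subv0; apply/subvP => w; rewrite memv_cap memv0.
by move=> /andP[sw /KE Yw]; rewrite (s0 w).
Qed.

Lemma common_kernel (s : seq I) :
  exists K : {vspace W}, forall w, w \in K <-> {in s, forall p, Y p w = 0}.
Proof.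
elim: s => [|p s [K KE]]; first by exists fullv => w; rewrite memvf.
exists (lker (Y p) :&: K)%VS => w; rewrite memv_cap memv_ker; split.
  by move=> /andP[/eqP Yw /KE Kw] q; rewrite inE => /predU1P[->//|]; exact: Kw.
move=> Yw; rewrite Yw ?mem_head // eqxx; apply/KE => q qs.
by apply: Yw; rewrite inE qs orbT.
Qed.

Lemma dual_family_dual_basis (s : seq I) (K : set W) : uniq s ->
  {in s &, forall p q, Y p (X q) = (p == q)%:R} ->
  (forall w, K w -> {in s, forall p, Y p w = 0}) ->
  dual_basis (map X s) (map Y s) K.
Proof.
move=> us dual K0; split; first by rewrite !size_map.
  move=> a b; rewrite size_map => sa sb.
  case: s us dual K0 sa sb => // p0 s us dual _ sa sb.
  by rewrite !(nth_map p0) // dual ?mem_nth // nth_uniq.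
move=> a w; rewrite size_map => sa Kw; case: s us dual K0 sa => // p0 s us _ K0 sa.
by rewrite (nth_map p0) // (K0 w) ?mem_nth.
Qed.

End Lists.
End DualFamilies.

Lemma map_frame (A B : Type) (g : A -> B) N n r k (e : 'I_N -> A) (f : 'I_n -> A)
    (E : seq 'I_N -> seq 'I_n -> A) :
  map g (frame r k e f E) =
  frame r k (fun i => g (e i)) (fun mu => g (f mu)) (fun J M => g (E J M)).
Proof.
rewrite /frame !map_cat -!map_comp map_flatten -map_comp; congr (_ ++ (_ ++ flatten _)).
by apply: eq_map => s /=; rewrite map_allpairs.
Qed.

Section FrameIndex.
Context (N n r k : nat).
Local Notation A := ('I_N + 'I_n)%type.

Definition frame_index : seq (A + seq 'I_N * seq 'I_n) :=
  frame r k (fun i => inl (inl i)) (fun mu => inl (inr mu)) (fun J M => inr (J, M)).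

Lemma mem_frame_index_vector (a : A) : inl a \in frame_index.
Proof.
by case: a => [i|mu]; rewrite !mem_cat map_f ?mem_enum ?orbT.
Qed.

Lemma mem_frame_index_momentum J M : reflect
  (exists s, [/\ (s < r)%N, J \in increasing N s & M \in increasing n (k - s)])
  (inr (J, M) \in frame_index).
Proof.
rewrite !mem_cat; apply: (iffP or3P) => [[/mapP[]//|/mapP[]//|]|[s [sr Js Ms]]].
  case/flattenP => l /mapP[s]; rewrite mem_iota /= => sr -> /allpairsP[[J' M'] /=].
  by move=> [J's M's [-> ->]]; exists s.
apply: Or33; apply/flattenP;
  exists [seq inr (J, M) | J <- increasing N s, M <- increasing n (k - s)].
  by apply: map_f; rewrite mem_iota.
by apply: allpairs_f.
Qed.

Lemma increasing_list_uniq p s : uniq (increasing p s).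
Proof. by rewrite filter_uniq // map_inj_uniq ?enum_uniq //; exact: val_inj. Qed.

Lemma frame_index_uniq : uniq frame_index.
Proof.
rewrite /frame_index /frame cat_uniq; apply/and3P; split.
- by rewrite map_inj_uniq ?enum_uniq // => i j [].
- rewrite has_cat negb_or; apply/andP; split.
    by apply/hasPn => _ /mapP[mu _ ->]; apply/mapP => -[].
  apply/hasPn => p /flattenP[_ /mapP[s _ ->] /allpairsP[[J M] [_ _ ->]]].
  by apply/mapP => -[].
rewrite cat_uniq; apply/and3P; split.
- by rewrite map_inj_uniq ?enum_uniq // => i j [].
- apply/hasPn => p /flattenP[_ /mapP[s _ ->] /allpairsP[[J M] [_ _ ->]]].
  by apply/mapP => -[].
elim: (iota 0 r) (iota_uniq 0 r) => //= s l IH /andP[sl ul].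
rewrite cat_uniq IH // andbT; apply/andP; split.
  by apply: allpairs_uniq; rewrite ?increasing_list_uniq // => -[? ?] [? ?] _ _ [-> ->].
apply/hasPn => p /flattenP[_ /mapP[s' s'l ->] /allpairsP[[J M] /= [Js' _ ->]]].
apply/negP => /allpairsP[[J' M'] /= [Js _ [eJ _]]]; move: Js sl; rewrite -eJ.
move: Js'; rewrite !mem_increasing => /andP[/eqP -> _] /andP[/eqP <- _].
by rewrite s'l.
Qed.

End FrameIndex.

Theorem theorem6 (R : realType) (V W T : vectType R)
    (iota : 'Hom(V, W)) (pi : 'Hom(W, T)) (k r n N : nat)
    (omega : cochain W k.+1)
    (hexact : short_exact iota pi)
    (hn : n = \dim {:T})
    (hk : (1 <= k)%N)
    (hr : (1 <= r <= k.+1)%N)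
    (hrn : (k.+1 - r <= n)%N)
    (homega : multilagrangian (limg iota) N r omega) :
  exists (e : 'I_N -> W) (f : 'I_n -> W) (E : seq 'I_N -> seq 'I_n -> W),
    canonical_basis (limg iota) pi r omega e f E.
Proof.
have [_ Vker pi_onto] := hexact; have /andP[r0 rk] := hr.
have [[Aomega Vomega] nz [L [LV dV r1 flatL]]] := homega.
have {}r1 : (r = 1 -> N = 0)%N by case/r1.
have dW : \dim {:W} = (\dim (limg iota) + n)%N.
  by rewrite -(limg_ker_dim pi fullv) capfv -Vker pi_onto hn.
have [c0 [x F0]] := adapted_frame_exists LV dV dW.
have [c F omegac] := frame_correction Aomega Vomega flatL r0 F0.
have [E' E'E] := dual_momenta (c := c) Aomega.
have [E hE] := basis_momenta flatL r0 F.
have kerL : forall w, form_ker omega w -> w \in L.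
  apply: (form_ker_sub Aomega flatL r0 F omegac) => //.
  by rewrite -leq_subLR.
have szk s J M : (s < r)%N -> J \in increasing N s -> M \in increasing n (k - s) ->
    (size J + size M = k)%N /\ (size J < r)%N.
  move=> sr; rewrite !mem_increasing => /andP[/eqP sJ _] /andP[/eqP sM _].
  by rewrite sJ sM subnKC // -ltnS (leq_trans sr).
have LE s J M : (s < r)%N -> J \in increasing N s -> M \in increasing n (k - s) ->
    E J M \in L.
  by move=> sr Js Ms; have [a b] := szk _ _ _ sr Js Ms; case: (hE J M a b).
pose X p := match p with inl a => c a | inr q => E q.1 q.2 end.
pose Y p := match p with inl a => x a | inr q => E' q.1 q.2 end.
pose idx := frame_index N n r k.
have uidx : uniq idx by exact: frame_index_uniq.
have dual : {in idx &, forall p q, Y p (X q) = (p == q)%:R}.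
  move=> [a|[J M]] [b|[J' M']] /=.
  - by move=> _ _; rewrite (frame_dual F).
  - move=> _ /mem_frame_index_momentum[s [sr Js Ms]].
    by rewrite (frame_annih F) // (LE s).
  - by move=> _ _; rewrite (dual_momenta_frame omegac E'E).
  move=> /mem_frame_index_momentum[s [sr Js Ms]].
  move=> /mem_frame_index_momentum[s' [sr' Js' Ms']].
  have [sz _] := szk _ _ _ sr Js Ms; have [sz' Jr'] := szk _ _ _ sr' Js' Ms'.
  have [_ {}hE] := hE _ _ sz' Jr'.
  have sB : size (multi_index J M) == k by rewrite size_multi_index sz.
  have sD : size (multi_index J' M') == k by rewrite size_multi_index sz'.
  rewrite E'E sz eqxx (eval_seq_tuple _ (map_tuple c (Tuple sB))).
  rewrite (hE _ (Tuple sD)) //; case: eqP => [[eJ eM]|ne].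
    subst J' M'; rewrite (_ : Tuple sD = Tuple sB) ?delta_det_diag //; last first.
      exact: val_inj.
    rewrite /= cat_uniq !map_inj_uniq; try by move=> ? ? [].
    rewrite (increasing_uniq Js) (increasing_uniq Ms) andbT /=.
    by apply/hasPn => _ /mapP[i _ ->]; apply/mapP => -[].
  apply/eqP; apply: contraT => /delta_det_perm /= /multi_index_perm_eq[JJ' MM'].
  case: ne; rewrite (increasing_perm_eq Js' Js JJ').
  by rewrite (increasing_perm_eq Ms' Ms MM').
have Yker w : form_ker omega w -> {in idx, forall p, Y p w = 0}.
  move=> wK [a _|[J M] _] /=; first by rewrite (frame_annih F) ?kerL.
  rewrite E'E; case: eqP => // _; rewrite /eval_seq.
  by move: wK; rewrite /form_ker /= => ->.
have kerY w : {in idx, forall p, Y p w = 0} -> form_ker omega w.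
  move=> Yw; apply: (dual_momenta_eq0 Aomega Vomega flatL F E'E).
    rewrite -[w](subrK (\sum_a x a w *: c a)) memvD ?(frame_decomp F) //.
    rewrite memv_suml // => a _.
    by rewrite (Yw (inl a)) ?mem_frame_index_vector // scale0r mem0v.
  move=> s J M sr _ Js Ms; apply: (Yw (inr (J, M))).
  by apply/mem_frame_index_momentum; exists s.
have [K KE] := @common_kernel _ _ _ Y idx.
have [fX addK capK] := dual_family_complement uidx dual KE.
exists (fun i => c (inl i)), (fun mu => c (inr mu)), E.
have XE : frame r k (fun i => c (inl i)) (fun mu => c (inr mu)) E = map X idx.
  by rewrite /idx map_frame.
split.
- rewrite XE; split=> //; exists K; split=> //; apply/seteqP; split=> w /=.
    by move/KE; exact: kerY.
  by move=> wK; apply/KE; exact: Yker.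
- exact: frame_vert F.
- by move=> s sr J M Js Ms; rewrite (subvP LV) // (LE s).
- rewrite basisEdim size_map size_enum_ord -hn leqnn andbT -pi_onto.
  apply/subvP => _ /memv_imgP[w _ ->].
  have : pi (w - \sum_a x a w *: c a) == 0.
    by rewrite -memv_ker -Vker (subvP LV) // (frame_decomp F).
  rewrite linearB subr_eq0 linear_sum => /eqP ->; apply: memv_suml => -[i|mu] _.
    have : c (inl i) \in lker pi by rewrite -Vker; exact: frame_vert F i.
    by rewrite memv_ker linearZ /= => /eqP ->; rewrite scaler0 mem0v.
  by rewrite linearZ memvZ // memv_span // (map_f (fun nu => pi (c (inr nu)))) // mem_enum.
exists (x \o inl), (x \o inr), E'; split.
- have -> : frame r k (x \o inl) (x \o inr) E' = map Y idx by rewrite /idx map_frame.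
  by rewrite XE; exact: dual_family_dual_basis.
- exact: (dual_momenta_biantisymmetric Aomega E'E).
- exact: (omega_canonical_form Aomega Vomega flatL F omegac E'E).
Qed.
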